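(* Let $G$ be a graph with a $k$-coloring in which $r$ color-classes have cardinality $1$. Then $\mathrm{fdim}(G)\le 2\cdot k-r-1$.
   Context: $\mathbb{N}=\{0,1,2,\dots\}$. Graphs are finite and simple, i.e. undirected, without loops or multiple edges. A $k$-coloring is a coloring of the vertices with $k$ colors in which adjacent vertices have different colors; its color-classes are the sets of vertices of the same color. A polytope $P\subset\mathbb{Q}^d$ is a lattice polytope if all its vertices are in $\mathbb{Z}^d$. A finite set $\mathcal{M}\subset\mathbb{Z}^d\setminus\{0\}$ is a set of moves if $\mathcal{M}=-\mathcal{M}$ and if for all $\lambda\in\mathbb{N}$ with $\lambda\ge 2$ and all $m\in\mathcal{M}$, $\lambda\cdot m\notin\mathcal{M}$. For a lattice polytope $P\subset\mathbb{Q}^d$ and a set of moves $\mathcal{M}\subset\mathbb{Z}^d$, the fiber graph $P(\mathcal{M})$ is the graph with node set $P\cap\mathbb{Z}^d$ in which two nodes $u$ and $v$ are adjacent if $u-v\in\mathcal{M}$. The fiber dimension $\mathrm{fdim}(G)$ of a graph $G$ is the smallest $d\in\mathbb{N}$ such that there exist a full dimensional (i.e. $d$-dimensional) lattice polytope $P\subset\mathbb{Q}^d_{\ge 0}$ and a set of moves $\mathcal{M}\subset\mathbb{Z}^d$ with $G\cong P(\mathcal{M})$. *)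

(* Defs.v *)
From HB Require Import structures.
From mathcomp Require Import all_boot all_order all_algebra.
From mathcomp Require Import boolp classical_sets cardinality.

Set Implicit Arguments.
Unset Strict Implicit.
Unset Printing Implicit Defensive.

Import Order.TTheory GRing.Theory Num.Theory.

Local Open Scope classical_set_scope.
Local Open Scope ring_scope.

Definition simple_graph (V : finType) (e : rel V) : Prop :=
  symmetric e /\ irreflexive e.

Definition graph_iso (V W : Type) (e : rel V) (e' : rel W) : Prop :=
  exists2 f : V -> W, bijective f & {mono f : x y / e x y >-> e' x y}.

(* Some colors of 'I_k may be unused. *)
Definition proper_coloring (V : finType) (e : rel V) (k : nat)
    (c : V -> 'I_k) : Prop :=
  forall u v, e u v -> c u != c v.

Definition color_class (V : finType) (k : nat) (c : V -> 'I_k) (i : 'I_k) :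
    {set V} := [set v | c v == i]%SET.

Definition singleton_classes (V : finType) (k : nat) (c : V -> 'I_k) : nat :=
  #|[set i : 'I_k | #|color_class c i| == 1%N]%SET|.

Section Polytopes.
Variable d : nat.
Implicit Types (A P : set 'rV[rat]_d) (x y v : 'rV[rat]_d).

Definition convex_hull A : set 'rV[rat]_d :=
  [set x | exists n (p : 'I_n -> 'rV[rat]_d) (w : 'I_n -> rat),
     [/\ forall i, A (p i), forall i, 0 <= w i,
         \sum_(i < n) w i = 1 & x = \sum_(i < n) w i *: p i]].

Definition affine_hull A : set 'rV[rat]_d :=
  [set x | exists n (p : 'I_n -> 'rV[rat]_d) (w : 'I_n -> rat),
     [/\ forall i, A (p i),
         \sum_(i < n) w i = 1 & x = \sum_(i < n) w i *: p i]].

Definition polytope P : Prop :=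
  exists s : seq 'rV[rat]_d, P = convex_hull [set` s].

(* A vertex is a zero-dimensional face: the unique maximizer over P of some
   linear functional. *)
Definition vertex P v : Prop :=
  P v /\ exists a : 'cV[rat]_d,
    forall x, P x -> x != v -> (x *m a) 0 0 < (v *m a) 0 0.

Definition int_vec (u : 'rV[int]_d) : 'rV[rat]_d := map_mx intr u.

Definition lattice_polytope P : Prop :=
  polytope P /\ forall v, vertex P v -> exists u, v = int_vec u.

(* Dimension of the affine hull; no n satisfies this when P is empty. *)
Definition has_dim P (n : nat) : Prop :=
  exists (x0 : 'rV[rat]_d) (U : {vspace 'rV[rat]_d}),
    affine_hull P = [set x | x - x0 \in U] /\ \dim U = n.

Definition nonneg_orthant : set 'rV[rat]_d := [set x | forall i, 0 <= x 0 i].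

Definition set_of_moves (M : set 'rV[int]_d) : Prop :=
  [/\ finite_set M, ~ M 0, M = [set - m | m in M] &
      forall (l : nat) m, (2 <= l)%N -> M m -> ~ M (m *+ l)].

Definition lattice_points P : set 'rV[int]_d := [set u | P (int_vec u)].

Definition fiber_graph P (M : set 'rV[int]_d) : rel (lattice_points P) :=
  fun p q => (\val p - \val q) \in M.

End Polytopes.

Definition fiber_realizable (V : finType) (e : rel V) (d : nat) : Prop :=
  exists (P : set 'rV[rat]_d) (M : set 'rV[int]_d),
    [/\ lattice_polytope P, has_dim P d, P `<=` @nonneg_orthant d,
        set_of_moves M & graph_iso e (@fiber_graph d P M)].

(* Relational: "fdim(G) exists and equals d". *)
Definition is_fdim (V : finType) (e : rel V) (d : nat) : Prop :=
  fiber_realizable e d /\ forall d', fiber_realizable e d' -> (d <= d')%N.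

(* Main.v *)
Require Import Defs.
From mathcomp Require Import all_boot all_order all_algebra.
From mathcomp Require Import boolp classical_sets cardinality.
From mathcomp Require Import lra zify.

(** The graph is realized inside a Cayley polytope. The vertices of one color
    form an independent set, so they may be strung along a line: the class of
    color [i], with [n_i] members, becomes the lattice segment from [e_i] to
    [e_i + (n_i - 1) f_i], which is a single point when [n_i = 1]. The [e_i]
    and the [f_i] with [1 < n_i] are independent directions, except that one
    fixed nonempty color [i0] gets [e_i0 = 0]. If all colors are used this takes
    [(k - 1) + (k - r)] coordinates, and every unused color saves two of them.

    Let [P] be the convex hull of these segments. In a lattice point of [P],
    the total weight of each class is a nonnegative integer and these sum to
    [1]; hence one class carries all the weight, the point lies on its segment,
    and it is one of the prescribed points ([cayley_lattice]). So the lattice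
    points of [P] are the vertices of the graph.

    As moves take the differences of the endpoints of edges. Such a difference
    joins two distinct colors, and its coordinates then reveal first the two
    colors, then the position of each endpoint in its class; so it comes from
    one ordered pair of vertices only ([cayley_move_inj]), and no adjacency is
    created that was not in the graph. Moreover it has an entry [1] or [-1] in
    some [e_i] coordinate, where all moves have entries in [{-1, 0, 1}]; so no
    move is a multiple of another by a factor at least 2 ([cayley_edge_axis]).

    The bound on the least dimension follows, since every dimension in which
    the graph is realizable bounds it. *)

Set Implicit Arguments.
Unset Strict Implicit.
Unset Printing Implicit Defensive.

Import Order.TTheory GRing.Theory Num.Theory.

(** * Convex and affine hulls *)

Section Hulls.
Local Open Scope classical_set_scope.
Local Open Scope ring_scope.

Variable d : nat.
Implicit Types (A P : set 'rV[rat]_d) (x y : 'rV[rat]_d).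

Lemma sub_convex_hull A : A `<=` convex_hull A.
Proof.
move=> x Ax; exists 1%N, (fun=> x), (fun=> 1); split=> //.
  by rewrite big_ord1.
by rewrite big_ord1 scale1r.
Qed.

Lemma convex_hull_ge0 A :
  A `<=` @nonneg_orthant d -> convex_hull A `<=` @nonneg_orthant d.
Proof.
move=> A0 _ [n [p [w [Ap w0 _ ->]]]] j; rewrite summxE sumr_ge0 // => l _.
by rewrite mxE mulr_ge0 // A0.
Qed.

(** The maximum of a linear functional over a convex combination is at most its
    maximum over the points combined, so if [v] were not among these points it
    could not be the strict maximizer. *)
Lemma vertex_convex_hull A v : vertex (convex_hull A) v -> A v.
Proof.
move=> [[n [p [w [Ap w0 w1 vE]]]] [a amax]].
apply: contrapT => nAv.
have lt_p i : (p i *m a) 0 0 < (v *m a) 0 0.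
  apply: amax; first exact: sub_convex_hull.
  by apply/eqP => pv; apply: nAv; rewrite -pv.
have [l [_ wl]] : exists l, true /\ 0 < w l.
  by have [//|/= | l] := @psumr_neq0P _ _ xpredT w; [rewrite w1; apply/eqP|exists l].
have : (v *m a) 0 0 < (v *m a) 0 0; last by rewrite ltxx.
rewrite {1}vE mulmx_suml summxE -[ltRHS]mul1r -w1 mulr_suml.
rewrite (bigD1 l) //= [ltRHS](bigD1 l) //=; apply: ltr_leD.
  by rewrite -scalemxAl mxE ltr_pM2l.
by apply: ler_sum => i _; rewrite -scalemxAl mxE ler_wpM2l // ltW.
Qed.

(** Index sets other than ordinals are allowed here, so that an affine
    combination can be given by concatenating families of points. *)
Lemma affine_hull_fin A (I : finType) (p : I -> 'rV[rat]_d) (w : I -> rat) :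
  (forall i, A (p i)) -> \sum_i w i = 1 ->
  affine_hull A (\sum_i w i *: p i).
Proof.
move=> Ap w1; exists #|I|, (p \o enum_val), (w \o enum_val); split=> //=.
  by rewrite -w1 (reindex _ (onW_bij _ (enum_val_bij I))).
by rewrite (reindex _ (onW_bij _ (enum_val_bij I))).
Qed.

(** Differences of points of [A] are directions of its affine hull; once these
    contain every unit vector, each [x] is [x0] plus a combination of such
    differences, whose weights [t] and [- t] cancel in the total. *)
Lemma affine_hull_full A x0 (p q : 'I_d -> 'rV[rat]_d) :
    A x0 -> (forall j, A (p j)) -> (forall j, A (q j)) ->
    (forall j, p j - q j = delta_mx 0 j) ->
  affine_hull A = setT.
Proof.
move=> Ax0 Ap Aq pq; apply/seteqP; split=> // x _.
pose w (i : 'I_1 + ('I_d + 'I_d)) := match i with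
  | inl _ => 1 | inr (inl j) => (x - x0) 0 j | inr (inr j) => - (x - x0) 0 j
  end.
pose s (i : 'I_1 + ('I_d + 'I_d)) := match i with
  | inl _ => x0 | inr (inl j) => p j | inr (inr j) => q j
  end.
have -> : x = \sum_i w i *: s i.
  rewrite !big_sumType big_ord1 /= scale1r -big_split /=.
  under eq_bigr => j _ do rewrite scaleNr -scalerBr pq.
  by rewrite -row_sum_delta addrC subrK.
apply: affine_hull_fin => [[?|[j|j]]|] //=.
by rewrite !big_sumType big_ord1 /= -big_split /= big1 ?addr0 // => j _; rewrite subrr.
Qed.

Lemma has_dim_full P : affine_hull P = setT -> has_dim P d.
Proof.
move=> affP; exists 0, fullv; split; last by rewrite dimvf /dim /= mul1n.
by rewrite affP; apply/seteqP; split=> // x _; rewrite /= memvf.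
Qed.

End Hulls.

(** * Fiber graphs from vertex embeddings *)

Section Embedding.
Local Open Scope classical_set_scope.
Local Open Scope ring_scope.

Variables (V : finType) (e : rel V) (d : nat) (f : V -> 'rV[int]_d).

Definition hull_points : set 'rV[rat]_d := range (fun v => int_vec (f v)).

Definition edge_moves : set 'rV[int]_d :=
  [set m | exists u v, e u v /\ m = f u - f v].

Hypothesis e_sym : symmetric e.
Hypothesis f_ge0 : forall v j, 0 <= f v 0 j.
Hypothesis f_inj : injective f.
Hypothesis f_lattice :
  forall u, convex_hull hull_points (int_vec u) -> exists v, u = f v.
Hypothesis f_full : affine_hull hull_points = setT.
(** Without this, two vertices could differ by a move without being adjacent. *)
Hypothesis f_move :
  forall x y u v, e u v -> f x - f y = f u - f v -> e x y.
(** A coordinate that is [1] or [-1] on one move while it is at most [1] in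
    absolute value on all of them prevents proper multiples of that move. *)
Hypothesis f_edge : forall u v, e u v -> exists2 j, `|(f u - f v) 0 j| = 1 &
  forall x y, `|(f x - f y) 0 j| <= 1.

Lemma lattice_polytope_hull : lattice_polytope (convex_hull hull_points).
Proof.
split; last by move=> v /vertex_convex_hull[u _ <-]; exists (f u).
exists [seq int_vec (f v) | v : V]; congr convex_hull.
apply/seteqP; split=> x /=.
  by move=> [v _ <-]; apply/mapP; exists v; rewrite ?mem_enum.
by move=> /mapP[v _ ->]; exists v.
Qed.

Lemma affine_hull_convex_hull :
  affine_hull (convex_hull hull_points) = setT.
Proof.
apply/seteqP; split=> // x _.
have : affine_hull hull_points x by rewrite f_full.
move=> [n [p [w [Ap w1 xE]]]]; exists n, p, w; split=> // i.
exact: sub_convex_hull.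
Qed.

Lemma set_of_edge_moves : set_of_moves edge_moves.
Proof.
have edge_move m : edge_moves m -> exists j, `|m 0 j| = 1 /\
    forall m', edge_moves m' -> `|m' 0 j| <= 1.
  move=> [u [v [euv ->]]]; have [j j1 flat] := f_edge euv.
  by exists j; split=> // _ [x [y [_ ->]]].
split.
- apply: (@sub_finite_set _ _ (range (fun z => f z.1 - f z.2))).
    by move=> _ [u [v [_ ->]]]; exists (u, v).
  exact: finite_image.
- by move=> /edge_move[j []]; rewrite mxE normr0.
- have opp m : edge_moves m -> edge_moves (- m).
    by move=> [u [v [euv ->]]]; exists v, u; rewrite e_sym opprB.
  apply/seteqP; split=> m /=; last by move=> [? /opp ? <-].
  by move=> /opp ?; exists (- m); rewrite ?opprK.
- move=> l m l2 /edge_move[j [mj1 flat]] /flat.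
  rewrite mulmxnE normrMn mj1; lia.
Qed.

Lemma fiber_realizable_embedding : fiber_realizable e d.
Proof.
exists (convex_hull hull_points), edge_moves; split.
- exact: lattice_polytope_hull.
- by apply: has_dim_full; rewrite affine_hull_convex_hull.
- apply: convex_hull_ge0 => _ [v _ <-] j; rewrite mxE ler0z; exact: f_ge0.
- exact: set_of_edge_moves.
have f_hull v : f v \in lattice_points (convex_hull hull_points).
  by apply/mem_set/sub_convex_hull; exists v.
have f_onto (z : lattice_points (convex_hull hull_points)) :
    exists v, val z = f v.
  by apply: f_lattice; apply: set_mem (valP z).
have [g gE] := choice f_onto.
exists (fun v => exist _ (f v) (f_hull v)).
  exists g => [v|z]; first by apply: f_inj; rewrite -gE.
  by apply: val_inj; rewrite /= -gE.
move=> x y; apply/idP/idP => [/set_mem[u [v [euv]]]|exy].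
  exact: f_move euv.
by apply/mem_set; exists x, y.
Qed.

End Embedding.

(** * The Cayley embedding of a colored vertex set *)

Section Cayley.
Local Open Scope classical_set_scope.
Local Open Scope ring_scope.

Variables (V : finType) (k : nat) (c : V -> 'I_k) (i0 : 'I_k).

Definition rank_in_class (v : V) : nat := index v (enum (color_class c (c v))).

(** The coordinate [(i, true)] tells whether [v] has color [i]; the coordinate
    [(i, false)] is the position of [v] along the segment of color [i]. *)
Definition cayley_coord (q : 'I_k * bool) (v : V) : int :=
  (c v == q.1)%:R * (if q.2 then 1 else (rank_in_class v)%:R).

(** The axes kept are those that make the embedding full dimensional: the color
    indicators sum to [1], so the one of [i0] is redundant, and a class with
    fewer than two vertices has only position [0]. *)
Definition cayley_axes : {set 'I_k * bool} :=
  [set q | if q.2 then (q.1 != i0) && (0 < #|color_class c q.1|)%N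
           else (1 < #|color_class c q.1|)%N]%SET.

Definition cayley (v : V) : 'rV[int]_#|cayley_axes| :=
  \row_j cayley_coord (enum_val j) v.

Lemma mem_enum_class v i : (v \in enum (color_class c i)) = (c v == i).
Proof. by have -> := mem_enum (color_class c i) v; rewrite inE. Qed.

Lemma rank_in_class_lt v i :
  c v = i -> (rank_in_class v < #|color_class c i|)%N.
Proof. by move=> <-; rewrite cardE index_mem mem_enum_class. Qed.

Lemma color_class_gt0 v : (0 < #|color_class c (c v)|)%N.
Proof. exact: leq_ltn_trans (rank_in_class_lt erefl). Qed.

Lemma rank_in_class_inj u v :
  c u = c v -> rank_in_class u = rank_in_class v -> u = v.
Proof.
rewrite /rank_in_class => cuv; rewrite cuv => /(index_inj u); apply;
  by rewrite mem_enum_class ?cuv.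
Qed.

Lemma rank_in_class_onto i t : (t < #|color_class c i|)%N ->
  exists2 v, c v = i & rank_in_class v = t.
Proof.
move=> lt_t; have [v0 _] : exists v0, v0 \in color_class c i.
  by apply/card_gt0P; apply: leq_ltn_trans lt_t.
pose v := nth v0 (enum (color_class c i)) t.
have cv : c v = i.
  apply/eqP; rewrite -mem_enum_class mem_nth //.
  by rewrite -cardE.
by exists v; rewrite // /rank_in_class cv index_uniq ?enum_uniq // -cardE.
Qed.

Lemma cayley_ind_axis i : i != i0 -> (0 < #|color_class c i|)%N ->
  exists j, forall v, cayley v 0 j = (c v == i)%:R.
Proof.
move=> ii0 i_gt0; have qD : (i, true) \in cayley_axes by rewrite inE /= ii0.
exists (enum_rank_in qD (i, true)) => v.
by rewrite mxE enum_rankK_in // /cayley_coord /= mulr1.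
Qed.

Lemma cayley_rank_axis i : (1 < #|color_class c i|)%N ->
  exists j, forall v, cayley v 0 j = (c v == i)%:R * (rank_in_class v)%:R.
Proof.
move=> i_gt1; have qD : (i, false) \in cayley_axes by rewrite inE.
exists (enum_rank_in qD (i, false)) => v.
by rewrite mxE enum_rankK_in.
Qed.

(** All color indicators can be recovered from the embedding, including the one
    of [i0], because they sum to [1]. The difference form is what is needed to
    compare moves. *)
Lemma cayley_diff_class x y u v i :
    cayley x - cayley y = cayley u - cayley v ->
  (c x == i)%:R - (c y == i)%:R = (c u == i)%:R - (c v == i)%:R :> int.
Proof.
move=> /matrixP xyuv.
have off i' : i' != i0 ->
    (c x == i')%:R - (c y == i')%:R = (c u == i')%:R - (c v == i')%:R :> int.
  move=> i'0; have [i'_gt0|i'_eq0] := ltnP 0 #|color_class c i'|.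
    have [j jE] := cayley_ind_axis i'0 i'_gt0.
    have := xyuv 0 j; move: (jE x) (jE y) (jE u) (jE v).
    by rewrite !mxE => -> -> -> ->.
  have nc w : (c w == i') = false.
    by apply/negP => /eqP cw; move: (color_class_gt0 w); rewrite cw ltnNge i'_eq0.
  by rewrite !nc.
have [->|] := eqVneq i i0; last exact: off.
pose S w : int := \sum_(i' | i' != i0) (c w == i')%:R.
have total w : (c w == i0)%:R + S w = 1.
  transitivity (\sum_i' (c w == i')%:R : int); first by rewrite [RHS](bigD1 i0).
  rewrite (bigD1 (c w)) //= eqxx big1 ?addr0 // => i' /negPf.
  by rewrite eq_sym => ->.
have : S x - S y = S u - S v by rewrite -!sumrB; apply: eq_bigr.
move: (total x) (total y) (total u) (total v); lia.
Qed.

(** Positions are recovered in the same way: a class without a position axis has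
    at most one vertex, in position [0]. *)
Lemma cayley_diff_rank x y u v i :
    cayley x - cayley y = cayley u - cayley v ->
  (c x == i)%:R * (rank_in_class x)%:R - (c y == i)%:R * (rank_in_class y)%:R =
  (c u == i)%:R * (rank_in_class u)%:R - (c v == i)%:R * (rank_in_class v)%:R
  :> int.
Proof.
move=> /matrixP xyuv; have [i_gt1|i_le1] := ltnP 1 #|color_class c i|.
  have [j jE] := cayley_rank_axis i_gt1.
  have := xyuv 0 j; move: (jE x) (jE y) (jE u) (jE v).
  by rewrite !mxE => -> -> -> ->.
have rk0 w : (c w == i)%:R * (rank_in_class w)%:R = 0 :> int.
  have [/rank_in_class_lt lt_w|] := eqVneq (c w) i; last by rewrite mul0r.
  by rewrite (_ : rank_in_class w = 0%N) ?mulr0 //; lia.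
by rewrite !rk0.
Qed.

Lemma cayley_inj : injective cayley.
Proof.
move=> x y xy; have xyy : cayley x - cayley y = cayley y - cayley y by rewrite xy.
have cxy : c x = c y.
  have := cayley_diff_class (c x) xyy; rewrite eqxx subrr.
  by case: eqP => // _ /eqP.
apply: (rank_in_class_inj cxy).
have := cayley_diff_rank (c y) xyy; rewrite cxy eqxx subrr !mul1r; lia.
Qed.

(** The indicator difference of color [c u] is [1] and that of [c v] is [-1],
    which forces [c x = c u] and [c y = c v]; as these colors differ, the position
    coordinates of the two endpoints do not interfere. *)
Lemma cayley_move_inj x y u v : c u != c v ->
  cayley x - cayley y = cayley u - cayley v -> x = u /\ y = v.
Proof.
move=> cuv xyuv; have cvu : (c v == c u) = false by rewrite eq_sym (negPf cuv).
have cxu : c x = c u.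
  have := cayley_diff_class (c u) xyuv; rewrite eqxx cvu.
  by case: eqP => // _; case: eqP.
have cyv : c y = c v.
  have := cayley_diff_class (c v) xyuv; rewrite eqxx (negPf cuv).
  by case: (c y =P c v) => // _; case: eqP.
split; apply: rank_in_class_inj => //.
  have := cayley_diff_rank (c u) xyuv; rewrite cxu cyv eqxx cvu.
  rewrite !mul1r !mul0r; lia.
have := cayley_diff_rank (c v) xyuv; rewrite cxu cyv eqxx (negPf cuv).
rewrite !mul1r !mul0r; lia.
Qed.

(** At least one endpoint has a color other than [i0], and so an indicator axis. *)
Lemma cayley_edge_axis u v : c u != c v ->
  exists2 j, `|(cayley u - cayley v) 0 j| = 1 &
    forall x y, `|(cayley x - cayley y) 0 j| <= 1.
Proof.
move=> cuv; have [w wuv cw0] : exists2 w, (w == u) || (w == v) & c w != i0.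
  have [cu|] := eqVneq (c u) i0; last by exists u; rewrite ?eqxx.
  by exists v; rewrite ?eqxx ?orbT // -cu eq_sym.
have [j jE] := cayley_ind_axis cw0 (color_class_gt0 w).
exists j => [|x y]; rewrite !(mxE, jE); last first.
  by move: (jE x) (jE y); rewrite !mxE => -> ->; case: eqP; case: eqP.
move: (jE u) (jE v); rewrite !mxE => -> ->.
by case/orP: wuv => /eqP ->; rewrite eqxx ?[c v == _]eq_sym (negPf cuv).
Qed.

(** Integrality makes the weight of each color [0] or [1], so a single color [i]
    carries all the weight. The position coordinate of the point is then an
    average of positions in that class, hence an integer between [0] and
    [#|color_class c i| - 1], and every such integer is taken by some vertex. *)
Lemma cayley_lattice u :
  convex_hull (hull_points cayley) (int_vec u) -> exists v, u = cayley v.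
Proof.
move=> [n [p [w [Ap w_ge0 w1 uE]]]].
have /choice[s sE] : forall l, exists v, p l = int_vec (cayley v).
  by move=> l; have [v _ <-] := Ap l; exists v.
have u_coord j : (u 0 j)%:~R = \sum_l w l * (cayley (s l) 0 j)%:~R :> rat.
  have /matrixP/(_ 0 j) := uE; rewrite summxE mxE => ->.
  by apply: eq_bigr => l _; rewrite mxE sE mxE.
have [l0 w_l0] : exists l, 0 < w l.
  by have [//|/= | l ?] := @psumr_neq0P _ _ xpredT w; [rewrite w1; apply/eqP|exists l].
(* The color [i] is that of any vertex with nonzero weight and color other than
   [i0]; its indicator is a coordinate, so its weight is a positive integer. If
   there is no such vertex, then [i] is [i0]. *)
have [i supp] : exists i, forall l, c (s l) != i -> w l = 0.
  have [[l1 [cl1 w_l1]]|none] :=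
      pselect (exists l, c (s l) != i0 /\ w l != 0); last first.
    exists i0 => l cl; apply/eqP/negP => /negP wl.
    by apply: none; exists l.
  exists (c (s l1)) => l cl.
  have [j jE] := cayley_ind_axis cl1 (color_class_gt0 (s l1)).
  pose W := \sum_l w l * (c (s l) == c (s l1))%:R.
  have uW : (u 0 j)%:~R = W.
    by rewrite u_coord; apply: eq_bigr => l' _; rewrite jE; case: eqP.
  have W_gt0 : 0 < W.
    rewrite /W (bigD1 l1) //= eqxx mulr1 ltr_wpDr ?lt_neqAle ?w_ge0 1?eq_sym ?w_l1 //.
    by rewrite sumr_ge0 // => l' _; rewrite mulr_ge0 // ler0n.
  have W_ge1 : 1 <= W by move: W_gt0; rewrite -uW ltr0z (ler_int _ 1).
  have : W + w l <= 1.
    rewrite -w1 [leRHS](bigD1 l) //= [leLHS]addrC lerD2l.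
    rewrite {1}/W (bigD1 l) //= (negPf cl) mulr0 add0r.
    apply: ler_sum => l' _; case: eqP; rewrite ?mulr1 ?mulr0 ?w_ge0 //.
  have := w_ge0 l; lra.
have c_l0 : c (s l0) = i.
  by apply/eqP/negP => /negP /supp w0; rewrite w0 ltxx in w_l0.
(* [T] is the position coordinate, provided that the axis [(i, false)] exists. *)
pose T := \sum_l w l * (rank_in_class (s l))%:R.
have [v cv rkv] : exists2 v, c v = i &
    ((1 < #|color_class c i|)%N -> T = (rank_in_class v)%:R).
  have [i_gt1|] := ltnP 1 #|color_class c i|; last by exists (s l0).
  have [j jE] := cayley_rank_axis i_gt1.
  have uT : (u 0 j)%:~R = T.
    rewrite u_coord; apply: eq_bigr => l _; rewrite jE.
    have [_|/supp ->] := eqVneq (c (s l)) i; last by rewrite !mul0r.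
    by rewrite mul1r natz.
  have T_ge0 : 0 <= T by rewrite sumr_ge0 // => l _; rewrite mulr_ge0 ?ler0n.
  have T_le : T <= (#|color_class c i|.-1)%:R.
    have -> : (#|color_class c i|.-1)%:R =
        \sum_l w l * (#|color_class c i|.-1)%:R by rewrite -mulr_suml w1 mul1r.
    apply: ler_sum => l _.
    have [/rank_in_class_lt ?|/supp ->] := eqVneq (c (s l)) i; last by rewrite !mul0r.
    by rewrite ler_wpM2l // ler_nat; lia.
  move: T_ge0 T_le uT; case: (u 0 j) => t + + uT; rewrite -uT.
    move=> _; rewrite ler_nat => t_le.
    have [|v cv rk] := @rank_in_class_onto i t; first by lia.
    by exists v => // _; rewrite rk.
  by rewrite ler0z.
exists v; apply/matrixP => i1 j; rewrite ord1 {i1}.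
have := enum_valP j; rewrite inE; case jE: (enum_val j) => [i' b] /= qD.
apply: (@intr_inj rat); rewrite u_coord.
have sj l : cayley (s l) 0 j = cayley_coord (i', b) (s l) by rewrite mxE jE.
under eq_bigr => l _ do rewrite sj.
rewrite mxE jE /cayley_coord /= cv {sj}.
have [ii'|ii'] := eqVneq i i'; last first.
  rewrite mul0r big1 // => l _.
  have [->|/supp ->] := eqVneq (c (s l)) i; last by rewrite mul0r.
  by rewrite (negPf ii') mul0r mulr0.
rewrite mul1r; transitivity (\sum_l w l * (if b then 1 else rank_in_class (s l))%:R).
  apply: eq_bigr => l _.
  have [->|/supp ->] := eqVneq (c (s l)) i; last by rewrite !mul0r.
  by rewrite ii' eqxx mul1r; case: b {qD jE}; rewrite ?natz.
case: b qD {jE} => qD; last by rewrite natz; apply: rkv; rewrite ii'.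
by under eq_bigr => l _ do rewrite mulr1.
Qed.

(** An indicator axis is the difference between the origin, which is the first
    vertex of color [i0], and the first vertex of its color; a position axis is
    the difference of the first two vertices of its color. *)
Lemma cayley_axis_diff q : (0 < #|color_class c i0|)%N -> q \in cayley_axes ->
  exists u v, forall q', q' \in cayley_axes ->
    cayley_coord q' u - cayley_coord q' v = (q' == q)%:R.
Proof.
move=> i0_gt0; case: q => i b; rewrite inE /=.
case: b => [/andP[ii0 i_gt0]|i_gt1].
  have [v0 cv0 rv0] := rank_in_class_onto i0_gt0.
  have [u cu ru] := rank_in_class_onto i_gt0.
  exists u, v0 => -[i' b]; rewrite /cayley_coord inE /= cu cv0 ru rv0.
  case: b => [/andP[i'0 _]|_].
    by rewrite !mulr1 [i0 == _]eq_sym (negPf i'0) subr0 xpair_eqE andbT eq_sym.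
  by rewrite !mulr0 xpair_eqE andbF.
have [u cu ru] := rank_in_class_onto i_gt1.
have [v cv rv] := rank_in_class_onto (ltnW i_gt1).
exists u, v => -[i' b] _; rewrite /cayley_coord /= cu cv ru rv xpair_eqE.
by case: b; rewrite ?mulr1 ?mulr0 ?subrr ?subr0 ?andbF ?andbT // eq_sym.
Qed.

Lemma cayley_full : (0 < #|color_class c i0|)%N ->
  affine_hull (hull_points cayley) = setT.
Proof.
move=> i0_gt0; have [v0 _ _] := rank_in_class_onto i0_gt0.
have hull v : hull_points cayley (int_vec (cayley v)) by exists v.
have /choice[pq pqE] : forall j, exists pq : V * V,
    int_vec (cayley pq.1) - int_vec (cayley pq.2) = delta_mx 0 j.
  move=> j; have [u [v uvE]] := cayley_axis_diff i0_gt0 (enum_valP j).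
  exists (u, v); apply/matrixP => z j'.
  rewrite !mxE /= -rmorphB /= uvE ?enum_valP // ord1 eqxx /=.
  by rewrite (inj_eq enum_val_inj); case: eqP.
exact: (affine_hull_full (hull v0) (fun j => hull (pq j).1)
          (fun j => hull (pq j).2) pqE).
Qed.

(** Counted color by color: the axes of color [i], plus [1] if [i] has a single
    vertex, plus [1] if [i] is [i0], are at most [2]. *)
Lemma card_cayley_axes :
  (#|cayley_axes| <= 2 * k - singleton_classes c - 1)%N.
Proof.
have axesE : #|cayley_axes| = (\sum_(i : 'I_k)
    (((i, true) \in cayley_axes) + ((i, false) \in cayley_axes)))%N.
  rewrite -sum1_card big_mkcond /=.
  transitivity (\sum_(i : 'I_k) \sum_b ((i, b) \in cayley_axes) : nat)%N.
    by rewrite pair_bigA; apply: eq_bigr => -[i b] _ /=; case: ifP.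
  by apply: eq_bigr => i _; rewrite big_bool.
have singletonsE : singleton_classes c =
    (\sum_(i : 'I_k) (#|color_class c i| == 1))%N.
  rewrite /singleton_classes -sum1_card big_mkcond /=.
  by apply: eq_bigr => i _; rewrite inE; case: ifP.
have i0E : 1%N = (\sum_(i : 'I_k) (i == i0))%N.
  by rewrite (bigD1 i0) //= eqxx big1 // => i /negPf ->.
have kE : (2 * k)%N = (\sum_(i : 'I_k) 2)%N by rewrite sum_nat_const card_ord mulnC.
suff : (#|cayley_axes| + singleton_classes c + 1 <= 2 * k)%N by lia.
rewrite kE axesE singletonsE [X in (_ + X)%N]i0E -!big_split /=.
apply: leq_sum => i _; rewrite !inE /=.
by case: (i == i0); case: #|color_class c i| => [|[|?]].
Qed.

End Cayley.

(** * The bound on the fiber dimension *)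

Lemma fiber_realizable_coloring (V : finType) (e : rel V) (k : nat)
    (c : V -> 'I_k) (i0 : 'I_k) :
    simple_graph e -> proper_coloring e c -> 0 < #|color_class c i0| ->
  fiber_realizable e #|cayley_axes c i0|.
Proof.
move=> [e_sym _] hc i0_gt0; apply: (@fiber_realizable_embedding _ _ _ (cayley c i0)) => //.
- move=> v j; rewrite mxE /cayley_coord.
  by apply: mulr_ge0; [|case: (enum_val j).2]; rewrite ?ler0n.
- exact: cayley_inj.
- exact: cayley_lattice.
- exact: cayley_full.
- by move=> x y u v euv /(cayley_move_inj (hc _ _ euv))[-> ->].
- by move=> u v /hc; apply: cayley_edge_axis.
Qed.

Theorem theorem3p5 (V : finType) (e : rel V) (hV : 0 < #|V|)
    (he : simple_graph e) (k r : nat) (c : V -> 'I_k)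
    (hc : proper_coloring e c) (hr : singleton_classes c = r) :
  exists2 d : nat, is_fdim e d & d <= 2 * k - r - 1.
Proof.
have [v0 _] := card_gt0P hV; rewrite -hr.
have i0_gt0 := color_class_gt0 c v0.
have realizable := fiber_realizable_coloring he hc i0_gt0.
have ex_d : exists d, `[< fiber_realizable e d >].
  by exists #|cayley_axes c (c v0)|; apply/asboolP.
have [d /asboolP real_d min_d] := ex_minnP ex_d; exists d.
  by split=> // d' /asboolP; apply: min_d.
exact: leq_trans (min_d _ (asboolT realizable)) (card_cayley_axes c (c v0)).
Qed.
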